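(* Let $(A_1,L_1)$ and $(A_2,L_2)$ be two $C^\ast$-metric algebras whose Lip-norms $L_1$ and $L_2$ are lower semicontinuous. Let $T$ be a unital $^\ast$-homomorphism from $(A_1,L_1)$ into $(A_2,L_2)$, i.e. a unital $^\ast$-homomorphism $T:A_1\to A_2$ of $C^\ast$-algebras such that $T(\mathcal{A}_1)\subseteq\mathcal{A}_2$, where $\mathcal{A}_i=\{a\in A_i: L_i(a)<\infty\}$ for $i=1,2$. Then $T$ is Lipschitz: there is a constant $\mu\ge 0$ such that $L_2(T(a))\le \mu L_1(a)$ for all $a\in\mathcal{A}_1$.
   Context: For a unital $C^\ast$-algebra $A$, let $1_A$ be its identity and $S(A)$ its state space. A Lip-norm on $A$ is a seminorm $L$ on $A$, possibly taking the value $+\infty$, such that (1) $L(1_A)=0$; (2) $L(a^\ast)=L(a)$ for all $a\in A$; (3) the metric $\rho_L(\varphi,\psi)=\sup\{|\varphi(a)-\psi(a)|: a\in A,\ L(a)\le 1\}$ on $S(A)$ induces the weak$^\ast$-topology on $S(A)$. A seminorm $L$ on $A$ (possibly taking the value $+\infty$) is lower semicontinuous if for one (hence all) $r\in\mathbb{R}_{>0}$ the set $\{a\in A: L(a)\le r\}$ is norm-closed in $A$. It is Leibniz if $L(ab)\le L(a)\|b\|+\|a\|L(b)$ for all $a,b\in\mathcal{A}=\{a\in A: L(a)<\infty\}$. A $C^\ast$-metric algebra is a pair $(A,L)$ consisting of a unital $C^\ast$-algebra $A$ and a Leibniz Lip-norm $L$ on $A$. *)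

(* Defs.v *)
From HB Require Import structures.
From mathcomp Require Import all_boot all_order all_algebra complex.
From mathcomp Require Import all_classical all_reals all_analysis.

Set Implicit Arguments.
Unset Strict Implicit.
Unset Printing Implicit Defensive.

Import Order.TTheory GRing.Theory Num.Theory.
Import numFieldNormedType.Exports.
Import Normc.

Local Open Scope classical_set_scope.
Local Open Scope ring_scope.
Local Open Scope complex_scope.

(* normc z : R is the modulus of z : R[i]. *)
HB.mixin Record Algebra_hasNorm (R : realType) A of GRing.Algebra R[i] A := {
  cnorm : A -> R ;
  cnormD : forall a b : A, cnorm (a + b) <= cnorm a + cnorm b ;
  cnormZ : forall (k : R[i]) (a : A), cnorm (k *: a) = normc k * cnorm a ;
  cnorm0_eq0 : forall a : A, cnorm a = 0 -> a = 0 ;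
  cnormM : forall a b : A, cnorm (a * b) <= cnorm a * cnorm b
}.

#[short(type="normedAlgType")]
HB.structure Definition NormedAlg (R : realType) :=
  { A of Algebra_hasNorm R A & GRing.Algebra R[i] A }.

(* The real normed space underlying A, as a copy of the carrier: the hierarchy
   has no join of the ring and normed module structures, so A cannot itself be
   a normedModType. It serves only to give A its norm topology. *)
Definition normed_copy (R : realType) (A : normedAlgType R) : Type := A.

Section NormedCopy.
Variables (R : realType) (A : normedAlgType R).
Local Notation V := (normed_copy A).

HB.instance Definition _ := GRing.Zmodule.copy V A.

Definition real_scale (r : R) (v : V) : V := (r%:C *: (v : A) : A).

Lemma real_scaleA r s v : real_scale r (real_scale s v) = real_scale (r * s) v.
Proof. by rewrite /real_scale scalerA rmorphM. Qed.
Lemma real_scale1 : left_id 1 real_scale.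
Proof. by move=> v; rewrite /real_scale rmorph1 scale1r. Qed.
Lemma real_scaleDr : right_distributive real_scale +%R.
Proof. by move=> r u v; rewrite /real_scale scalerDr. Qed.
Lemma real_scaleDl v : {morph real_scale^~ v : r s / r + s}.
Proof. by move=> r s; rewrite /real_scale rmorphD scalerDl. Qed.

HB.instance Definition _ :=
  GRing.Zmodule_isLmodule.Build R V
    real_scaleA real_scale1 real_scaleDr real_scaleDl.

Definition copy_norm (v : V) : R := cnorm (v : A).

Lemma copy_normD u v : copy_norm (u + v) <= copy_norm u + copy_norm v.
Proof. exact: cnormD. Qed.
Lemma copy_normZ (r : R) v : copy_norm (r *: v) = `|r| * copy_norm v.
Proof.
rewrite /copy_norm [r *: v]/(real_scale r v) cnormZ.
by rewrite /normc /= expr0n addr0 sqrtr_sqr.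
Qed.
Lemma copy_norm0_eq0 v : copy_norm v = 0 -> v = 0.
Proof. exact: cnorm0_eq0. Qed.

HB.instance Definition _ :=
  Lmodule_isNormed.Build R V copy_normD copy_normZ copy_norm0_eq0.

End NormedCopy.

HB.mixin Record NormedAlg_isCStar (R : realType) A of NormedAlg R A := {
  cauchy_cvg_normed_copy : forall F : set_system (normed_copy A),
    ProperFilter F -> cauchy F -> cvg F ;
  star : A -> A ;
  starK : involutive star ;
  starD : {morph star : a b / a + b} ;
  starZ : forall (k : R[i]) a, star (k *: a) = k^*%C *: star a ;
  starM : forall a b, star (a * b) = star b * star a ;
  cnorm_starM : forall a, cnorm (star a * a) = cnorm a ^+ 2
}.

#[short(type="cstarAlgType")]
HB.structure Definition CStarAlg (R : realType) :=
  { A of NormedAlg_isCStar R A & NormedAlg R A }.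

HB.instance Definition _ (R : realType) (A : cstarAlgType R) :=
  Uniform_isComplete.Build (normed_copy A) (@cauchy_cvg_normed_copy R A).

Section CStarMetric.
Variables (R : realType) (A : cstarAlgType R).

(* In R[i], 0 <= z means that z is real and nonnegative. *)
Definition is_state (phi : A -> R[i]) : Prop :=
  [/\ scalar phi, forall a, 0 <= phi (star a * a) & phi 1 = 1].

(* The topology of set_type is the one induced by the ambient space, here the
   functions A -> R[i] with pointwise convergence, i.e. the weak-star topology.
   The regular algebra R[i]^o is R[i] with its topology. *)
Definition states : topologicalType :=
  set_type [set phi : {ptws A -> R[i]^o} | is_state phi].

Definition state_fun (phi : states) : A -> R[i] := set_val phi.

Local Open Scope ereal_scope.

(* As 0 * +oo = 0 in \bar R, homogeneity includes L 0 = 0. *)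
Definition is_seminorm (L : A -> \bar R) : Prop :=
  [/\ forall a, 0 <= L a,
      forall (k : R[i]) a, L (k *: a)%R = (normc k)%:E * L a
    & forall a b, L (a + b)%R <= L a + L b].

Definition lip_dist (L : A -> \bar R) (phi psi : states) : \bar R :=
  ereal_sup [set (normc (state_fun phi a - state_fun psi a)%R)%:E
            | a in [set a | L a <= 1]].

Definition induces_weak_star (rho : states -> states -> \bar R) : Prop :=
  forall U : set states, open U <->
    forall phi, U phi ->
      exists2 e : R, (0 < e)%R & [set psi | rho phi psi < e%:E] `<=` U.

Definition lip_norm (L : A -> \bar R) : Prop :=
  [/\ is_seminorm L, L 1%R = 0, forall a, L (star a) = L a
    & induces_weak_star (lip_dist L)].

Definition lip_dom (L : A -> \bar R) : set A := [set a | L a < +oo].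

Definition leibniz (L : A -> \bar R) : Prop :=
  forall a b, lip_dom L a -> lip_dom L b ->
    L (a * b)%R <= L a * (cnorm b)%:E + (cnorm a)%:E * L b.

Definition cstar_metric (L : A -> \bar R) : Prop := lip_norm L /\ leibniz L.

Definition lsc_seminorm (L : A -> \bar R) : Prop :=
  exists2 r : R, (0 < r)%R & closed [set a : normed_copy A | L a <= r%:E].

End CStarMetric.

(* Main.v *)
Require Import Defs.
From HB Require Import structures.
From mathcomp Require Import all_boot all_order all_algebra complex ring lra.
From mathcomp Require Import all_classical all_reals all_analysis.
Import Order.TTheory GRing.Theory Num.Theory.
Import numFieldNormedType.Exports.
Local Open Scope classical_set_scope.
Local Open Scope ring_scope.

Set Implicit Arguments.
Unset Strict Implicit.
Unset Printing Implicit Defensive.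

(** By lower semicontinuity, [L2 \o T] is a lower semicontinuous finite seminorm
    on the closed convex set of the [a] with [L1 a <= 1] and [|a| <= 1], and a
    Baire argument on this set bounds it there. Subtracting a scalar from a
    self-adjoint [a] with [L1 a <= 1] does not change [L1 a] or [L2 (T a)] and
    brings [a] into a fixed multiple of the set: the states separate self-adjoint
    elements isometrically, and the [rho_L1]-diameter of the state space is
    finite, because all segments from a fixed state [phi] start within a common
    weak-star neighbourhood of [phi].

    Positivity is defined by the norm condition [|t - x| <= t] of Kelley and
    Vaught, which makes the cone visibly additive and stable under contractive
    unital maps and functionals. Square roots come from a fixed point, and the
    spectrum is never used. That [b^* b] is positive then rests on the equality
    of the norms of [x (x + t)^2] at [x = c^* c] and at [x = c c^*], for
    [c = b (1 - b^* b)^n]. States are obtained from the Hahn-Banach theorem. *)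

(** The error may be any fixed multiple of [e], so later estimates need not normalise their
    constants. Dividing by [|c| + 1] covers every sign of [c] at once. *)
Lemma ler_scaled_eps (R : realType) (c p q : R) :
  (forall e, 0 < e -> p <= q + c * e) -> p <= q.
Proof.
move=> le; apply/ler_addgt0Pr => e e0.
have c1 : 0 < `|c| + 1 by rewrite ltr_wpDl.
apply: le_trans (le (e / (`|c| + 1)) (divr_gt0 e0 c1)) _.
rewrite lerD2l mulrA ler_pdivrMr // mulrC ler_pM2l //.
by rewrite (le_trans (ler_norm c)) // lerDl.
Qed.

(** * Norm, involution and real scalars *)

Section NormAndStar.
Variables (R : realType) (A : cstarAlgType R).
Implicit Types (a b x y u : A) (s t : R).

Lemma cnorm_ge0 a : 0 <= cnorm a.
Proof. exact: (@normr_ge0 _ (normed_copy A) a). Qed.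

Lemma cnorm0 : cnorm (0 : A) = 0.
Proof. exact: (@normr0 _ (normed_copy A)). Qed.

Lemma cnormN a : cnorm (- a) = cnorm a.
Proof. exact: (@normrN _ (normed_copy A) a). Qed.

Lemma cnormB a b : cnorm (a - b) <= cnorm a + cnorm b.
Proof. exact: (@ler_normB _ (normed_copy A) a b). Qed.

Lemma cnorm_distC a b : cnorm (a - b) = cnorm (b - a).
Proof. exact: (@distrC _ (normed_copy A) a b). Qed.

Lemma cnorm_gt0 a : (0 < cnorm a) = (a != 0).
Proof. exact: (@normr_gt0 _ (normed_copy A) a). Qed.

Lemma cnorm_small_eq0 a C : (forall e, 0 < e -> cnorm a <= C * e) -> a = 0.
Proof.
move=> small; apply/cnorm0_eq0/eqP; rewrite eq_le cnorm_ge0 andbT.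
by apply: (@ler_scaled_eps _ C) => e /small; rewrite add0r.
Qed.

Lemma star0 : star (0 : A) = 0.
Proof. by apply: (addrI (star (0 : A))); rewrite -starD !addr0. Qed.

Lemma starN a : star (- a) = - star a.
Proof. by apply: (addrI (star a)); rewrite -starD !subrr star0. Qed.

Lemma starB a b : star (a - b) = star a - star b.
Proof. by rewrite starD starN. Qed.

Lemma star1 : star (1 : A) = 1.
Proof. by rewrite -[LHS]mul1r -[X in X * _](starK) -starM mul1r starK. Qed.

Lemma cnorm_star a : cnorm (star a) = cnorm a.
Proof.
have le x : cnorm x <= cnorm (star x).
  have [->|x0] := eqVneq x 0; first by rewrite star0.
  rewrite -(ler_pM2r (_ : 0 < cnorm x)) ?cnorm_gt0 //.
  by rewrite -expr2 -cnorm_starM cnormM.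
by apply/eqP; rewrite eq_le le -{2}(starK a) le.
Qed.

Lemma cnorm1 : cnorm (1 : A) = 1.
Proof.
have n1 : cnorm (1 : A) != 0 by rewrite gt_eqF // cnorm_gt0 oner_neq0.
by apply: (mulfI n1); rewrite mulr1 -expr2 -cnorm_starM star1 mulr1.
Qed.

(** Real scalars are taken as elements of the algebra, so that scaling becomes a product with a
    central self-adjoint element. *)
Definition scal t : A := (real_complex R t)%:A.

Lemma scal0 : scal 0 = 0. Proof. by rewrite /scal rmorph0 scale0r. Qed.
Lemma scal1 : scal 1 = 1. Proof. by rewrite /scal rmorph1 scale1r. Qed.
Lemma scalD s t : scal (s + t) = scal s + scal t.
Proof. by rewrite /scal rmorphD scalerDl. Qed.
Lemma scalN t : scal (- t) = - scal t.
Proof. by rewrite /scal rmorphN scaleNr. Qed.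
Lemma scalB s t : scal (s - t) = scal s - scal t.
Proof. by rewrite scalD scalN. Qed.
Lemma scalM s t : scal (s * t) = scal s * scal t.
Proof. by rewrite /scal rmorphM -scalerAl mul1r scalerA. Qed.
Lemma scalX t n : scal (t ^+ n) = scal t ^+ n.
Proof. by elim: n => [|n IH]; rewrite ?expr0 ?scal1 // !exprS scalM IH. Qed.
Lemma scal_comm t a : GRing.comm (scal t) a.
Proof. exact: comm_alg. Qed.
Lemma scalZ t a : real_complex R t *: a = scal t * a.
Proof. by rewrite -scalerAl mul1r. Qed.

Lemma cnorm_scalM t a : cnorm (scal t * a) = `|t| * cnorm a.
Proof.
by rewrite -scalZ cnormZ /Normc.normc /= expr0n addr0 sqrtr_sqr.
Qed.

Lemma cnorm_scal t : cnorm (scal t) = `|t|.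
Proof. by rewrite -[scal t]mulr1 cnorm_scalM cnorm1 mulr1. Qed.

Definition selfadj a := star a = a.

Lemma selfadj_scal t : selfadj (scal t).
Proof. by rewrite /selfadj /scal starZ star1 /= oppr0. Qed.
Lemma selfadjD a b : selfadj a -> selfadj b -> selfadj (a + b).
Proof. by rewrite /selfadj starD => -> ->. Qed.
Lemma selfadjN a : selfadj a -> selfadj (- a).
Proof. by rewrite /selfadj starN => ->. Qed.
Lemma selfadjB a b : selfadj a -> selfadj b -> selfadj (a - b).
Proof. by move=> sa sb; apply: selfadjD => //; exact: selfadjN. Qed.
Lemma selfadjM a b : selfadj a -> selfadj b -> GRing.comm a b -> selfadj (a * b).
Proof. by rewrite /selfadj starM => -> -> ->. Qed.
Lemma selfadjX a n : selfadj a -> selfadj (a ^+ n).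
Proof.
move=> sa; elim: n => [|n IH]; first by rewrite expr0 /selfadj star1.
by rewrite exprS; apply: selfadjM => //; exact: commrX.
Qed.
Lemma selfadj_scalM t a : selfadj a -> selfadj (scal t * a).
Proof. by move=> sa; apply: selfadjM (selfadj_scal t) sa (scal_comm t a). Qed.
Lemma selfadj_starM a : selfadj (star a * a).
Proof. by rewrite /selfadj starM starK. Qed.

Lemma cnorm_sqr a : selfadj a -> cnorm (a ^+ 2) = cnorm a ^+ 2.
Proof. by rewrite -cnorm_starM => ->. Qed.

End NormAndStar.

(** * Square roots *)

Section SquareRoot.
Variables (R : realType) (A : cstarAlgType R).
Implicit Types (a b x y u : A) (s t : R).

Lemma cnorm_closedP (U : set A) :
  closed (U : set (normed_copy A)) <->
  forall x, (forall e, 0 < e -> exists2 y, U y & cnorm (x - y) < e) -> U x.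
Proof.
split=> [clU x approx|approx x clx].
  apply: clU => B /nbhs_ballP[e /= e0 ballB].
  by have [y Uy xy] := approx e e0; exists y; split => //; exact: ballB.
apply: approx => e e0.
have [y [Uy xy]] := clx _ (nbhsx_ballx (x : normed_copy A) e e0).
by exists y.
Qed.

(* The equation [y + y = z + y ^+ 2] says that [1 - y] is a square root of
   [1 - z]; its right-hand side is a contraction of a ball of radius < 1. *)
Lemma sqrt_fixpoint z : selfadj z -> cnorm z < 1 ->
  exists y, [/\ selfadj y, y + y = z + y ^+ 2
    & forall w, GRing.comm z w -> GRing.comm y w].
Proof.
(* The midpoint of [|z|] and 1: as [|z| = 2 r - 1], the ball of radius [r < 1] is stable under
   [(z + y ^+ 2) / 2], and [r] is also the contraction constant. *)
move=> saz z1; set r := (1 + cnorm z) / 2.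
have z0 := cnorm_ge0 z.
have r0 : 0 <= r by rewrite /r; lra.
have r1 : r < 1 by rewrite /r; lra.
pose V := normed_copy A.
(* Self-adjointness and commutation with the commutant of [z] are closed conditions preserved by
   [f], so the fixed point inherits them. *)
pose U : set A := [set y : A | [/\ cnorm y <= r, selfadj y
  & forall w, GRing.comm z w -> GRing.comm y w]].
pose f : V -> V := fun y => scal A (2^-1) * (z + (y : A) ^+ 2).
have fU : {homo f : y / U y >-> U y}.
  move=> y [yr say cy]; split.
  - rewrite /f cnorm_scalM ger0_norm ?invr_ge0 //.
    rewrite mulrC ler_pdivrMr //; apply: le_trans (cnormD _ _) _.
    rewrite (cnorm_sqr say).
    have y0 := cnorm_ge0 (y : A).
    have : cnorm z = r * 2 - 1 by rewrite /r; lra.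
    by move=> ->; nra.
  - by apply: selfadj_scalM; apply: selfadjD => //; exact: selfadjX.
  - move=> w zw; apply: commr_sym; apply: commrM; first exact/commr_sym/scal_comm.
    by apply: commrD; [exact: commr_sym|apply: commrX; exact/commr_sym/cy].
have clU : closed (U : set V).
  apply/cnorm_closedP => x approx; split.
  - apply/ler_addgt0Pr => e /approx[y [yr _ _] xy].
    rewrite -[x](subrK y) addrC.
    by apply: le_trans (cnormD _ _) _; rewrite lerD // ltW.
  - apply/eqP; rewrite -subr_eq0; apply/eqP.
    apply: (@cnorm_small_eq0 _ _ _ 2) => e /approx[y [_ say _] xy].
    rewrite -(subrKA y) -{1}say -starB mulr_natl mulr2n.
    by rewrite (le_trans (cnormD _ _)) // cnorm_star cnorm_distC lerD // ltW //
      cnorm_distC.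
  - move=> w zw; apply/eqP; rewrite -subr_eq0; apply/eqP.
    apply: (@cnorm_small_eq0 _ _ _ (2 * cnorm w)) => e /approx[y [_ _ cy] xy].
    have -> : x * w - w * x = (x - y) * w - w * (x - y).
      by rewrite mulrBl mulrBr (cy w zw) opprB addrA subrK.
    have w0 := cnorm_ge0 w.
    rewrite (le_trans (cnormB _ _)) // (le_trans (lerD (cnormM _ _) (cnormM _ _))) //.
    by nra.
have U0 : U !=set0.
  exists 0; split; rewrite ?cnorm0 //; first exact: star0.
  by move=> w _; exact: commr_sym (commr0 _).
have [|y [_ say cy] fy] :=
  @banach_fixed_point R V U (mkfun fU) _ clU U0.
  exists (NngNum r0); split=> //= -[x y] [[xr _ _] [yr _ _]] /=.
  rewrite /f -mulrBr opprD addrACA subrr add0r.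
  have -> : (x : A) ^+ 2 - (y : A) ^+ 2 = x * (x - y : A) + (x - y : A) * y.
    by rewrite mulrBr mulrBl addrA subrK.
  rewrite [leLHS]cnorm_scalM ger0_norm ?invr_ge0 // mulrC ler_pdivrMr //.
  apply: le_trans (cnormD _ _) _.
  apply: le_trans (lerD (cnormM _ _) (cnormM _ _)) _.
  have := cnorm_ge0 (x - y : A); rewrite /Num.norm /= /copy_norm; nra.
exists y; split => //; rewrite {1 2}[y]fy /= /f -mulrDl -scalD.
by rewrite (_ : 2^-1 + 2^-1 = 1) ?scal1 ?mul1r //; lra.
Qed.

(** Rescaling: [z = 1 - x / t] has norm below 1, and [sqrt t (1 - y)] is a root of [x = t (1 - z)].
    The clause on commutants later makes roots of commuting elements commute. *)
Lemma sqrt_exists x t : selfadj x -> cnorm (scal A t - x) < t ->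
  exists u, [/\ selfadj u, x = u ^+ 2 & forall w, GRing.comm x w -> GRing.comm u w].
Proof.
move=> sax xt; have t0 : 0 < t := le_lt_trans (cnorm_ge0 _) xt.
set z := scal A t^-1 * (scal A t - x).
have saz : selfadj z by apply: selfadj_scalM; apply: selfadjB => //; exact: selfadj_scal.
have z1 : cnorm z < 1.
  by rewrite cnorm_scalM gtr0_norm ?invr_gt0 // mulrC ltr_pdivrMr // mul1r.
have [y [say yE cy]] := sqrt_fixpoint saz z1.
have xE : x = scal A t * (1 - z).
  rewrite mulrBr mulr1 /z mulrA -scalM mulfV ?gt_eqF // scal1 mul1r.
  by rewrite opprB addrCA subrr addr0.
exists (scal A (Num.sqrt t) * (1 - y)); split.
- by apply: selfadj_scalM; apply: selfadjB => //; exact: star1.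
- rewrite exprMn_comm; last exact: scal_comm.
  rewrite -scalX sqr_sqrtr ?ltW // {1}xE; congr (_ * _).
  rewrite expr2 mulrBr mulr1 mulrBl mul1r -expr2 -addrA -opprD addrA yE.
  by rewrite addrK.
- move=> w xw; apply: commr_sym; apply: commrM; first exact/commr_sym/scal_comm.
  apply: commrB; [exact: commr1|apply: commr_sym; apply: cy].
  apply: commr_sym; apply: commrM; first exact/commr_sym/scal_comm.
  apply: commrB; [exact/commr_sym/scal_comm|exact: commr_sym].
Qed.

End SquareRoot.

(** * The positive cone *)

Section Positivity.
Variables (R : realType) (A : cstarAlgType R).
Implicit Types (a b x y u : A) (s t e : R).

Local Notation imag := (Complex (0 : R) 1).

Lemma starZi a : star (imag *: a) = - (imag *: star a).
Proof.
rewrite starZ -scaleNr /=; congr (_ *: _).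
by apply/eqP; rewrite eq_complex /= oppr0 !eqxx.
Qed.

Lemma scal2M a : scal A 2 * a = a + a.
Proof. by rewrite (_ : 2 = 1 + 1) // scalD scal1 mulrDl mul1r. Qed.

(** For [d = u + i v] one has [star d * d = u ^+ 2 + v ^+ 2] by commutation, and [2 u = d + star d]
    gives [|u| <= |d|]. This is the source of all monotonicity of the norm below. *)
Lemma cnorm_sqr_le_add u v : selfadj u -> selfadj v -> GRing.comm u v ->
  cnorm u ^+ 2 <= cnorm (u ^+ 2 + v ^+ 2).
Proof.
move=> sau sav uv; pose d := u + imag *: v.
have sd : star d = u - imag *: v by rewrite /d starD starZi sau sav.
have <- : star d * d = u ^+ 2 + v ^+ 2.
  rewrite sd /d mulrDr !mulrBl -!scalerAl -!scalerAr -uv subrKA scalerA.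
  by rewrite -[_ * _ in X in _ - X]/('i%C ^+ 2) sqr_i scaleN1r opprK.
rewrite cnorm_starM ler_sqr ?nnegrE ?cnorm_ge0 //.
rewrite -(ler_pM2l (ltr0n R 2)) -{1}(ger0_norm (ler0n R 2)) -cnorm_scalM.
have -> : scal A 2 * u = d + star d.
  by rewrite sd addrACA subrr addr0 scal2M.
by rewrite (le_trans (cnormD _ _)) // cnorm_star mulr_natl mulr2n.
Qed.

Definition pos x := selfadj x /\ exists t, cnorm (scal A t - x) <= t.

(** Since [|u ^+ 2| < t], the element [t - u ^+ 2] is a square [m ^+ 2] with [m] commuting with [u],
    and [|m ^+ 2| <= |m ^+ 2 + u ^+ 2| = t]. *)
Lemma cnorm_scal_sub_sqr u t : selfadj u -> cnorm u ^+ 2 < t ->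
  cnorm (scal A t - u ^+ 2) <= t.
Proof.
move=> sau ut; have t0 : 0 <= t by rewrite ltW // (le_lt_trans _ ut) // sqr_ge0.
have [||m [sam mE cm]] := @sqrt_exists _ _ (scal A t - u ^+ 2) t.
- by apply: selfadjB; [exact: selfadj_scal|exact: selfadjX].
- by rewrite opprB addrCA subrr addr0 cnorm_sqr.
have mu : GRing.comm m u.
  apply: cm; apply: commr_sym; apply: commrB; first exact/commr_sym/scal_comm.
  by apply: commrX.
rewrite mE cnorm_sqr // (le_trans (cnorm_sqr_le_add sam sau mu)) //.
by rewrite -mE subrK cnorm_scal ger0_norm.
Qed.

Lemma pos_sqr u : selfadj u -> pos (u ^+ 2).
Proof.
move=> sau; split; first exact: selfadjX.
exists (cnorm u ^+ 2 + 1); apply: cnorm_scal_sub_sqr => //.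
by rewrite ltrDl.
Qed.

(** The shift by [e] makes the inequality in [pos] strict, as [sqrt_exists] requires. *)
Lemma pos_sqrt x e : pos x -> 0 < e ->
  exists u, [/\ selfadj u, x + scal A e = u ^+ 2
    & forall w, GRing.comm x w -> GRing.comm u w].
Proof.
move=> [sax [t xt]] e0.
have [||u [sau uE cu]] := @sqrt_exists _ _ (x + scal A e) (t + e).
- by apply: selfadjD => //; exact: selfadj_scal.
- by rewrite scalD opprD addrACA subrr addr0 (le_lt_trans xt) // ltrDl.
exists u; split => // w xw; apply: cu; apply: commr_sym; apply: commrD.
  exact: commr_sym.
exact/commr_sym/scal_comm.
Qed.

(** Frees positivity from the unspecified radius in [pos]. The element [x + e] is a square of norm
    below [t + 2 e], to which [cnorm_scal_sub_sqr] applies. *)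
Lemma pos_cnorm_sub x t : pos x -> cnorm x <= t -> cnorm (scal A t - x) <= t.
Proof.
move=> px xt; apply: (@ler_scaled_eps _ 4) => e e0.
have [u [sau uE _]] := pos_sqrt px e0.
have /(cnorm_scal_sub_sqr sau) : cnorm u ^+ 2 < t + 2 * e.
  rewrite -cnorm_sqr // -uE (le_lt_trans (cnormD _ _)) //.
  by rewrite cnorm_scal gtr0_norm //; lra.
rewrite -uE => ut.
have -> : scal A t - x = scal A (t + 2 * e) - (x + scal A e) - scal A e.
  rewrite -[RHS]addrA -opprD -[x + _ + _]addrA -scalD.
  rewrite (_ : e + e = 2 * e); last lra.
  by rewrite scalD opprD addrACA subrr addr0.
rewrite (le_trans (cnormB _ _)) // cnorm_scal gtr0_norm //; lra.
Qed.

Lemma pos_selfadj x : pos x -> selfadj x. Proof. by case. Qed.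

(** For [x + e] the radius [|x| + e] is admissible, and there the two shifts by [e] cancel. *)
Lemma pos_closed x : (forall e, 0 < e -> pos (x + scal A e)) -> pos x.
Proof.
move=> px; split.
  rewrite -(addrK (scal A 1) x); apply: selfadjB (selfadj_scal _ _).
  exact: (px 1 ltr01).1.
exists (cnorm x); apply/ler_addgt0Pr => e e0.
have := @pos_cnorm_sub _ (cnorm x + e) (px e e0).
rewrite scalD opprD addrACA subrr addr0; apply.
by rewrite (le_trans (cnormD _ _)) // cnorm_scal gtr0_norm.
Qed.

Lemma pos_scal_sub y t : selfadj y -> cnorm y <= t -> pos (scal A t - y).
Proof.
move=> say yt; split; first by apply: selfadjB => //; exact: selfadj_scal.
by exists t; rewrite opprB addrCA subrr addr0.
Qed.

Lemma posD x y : pos x -> pos y -> pos (x + y).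
Proof.
move=> [sax [s xs]] [say [t yt]]; split; first exact: selfadjD.
exists (s + t); rewrite scalD opprD addrACA.
by rewrite (le_trans (cnormD _ _)) // lerD.
Qed.

Lemma pos_scal t : 0 <= t -> pos (scal A t).
Proof.
by move=> t0; split; [exact: selfadj_scal|exists t; rewrite subrr cnorm0].
Qed.

Lemma pos_scalM t x : 0 <= t -> pos x -> pos (scal A t * x).
Proof.
move=> t0 [sax [s xs]]; split; first exact: selfadj_scalM.
by exists (t * s); rewrite scalM -mulrBr cnorm_scalM ger0_norm // ler_wpM2l.
Qed.

(** Commuting roots [u] of [x + e] and [v] of [t - x + e] satisfy
    [|u ^+ 2| <= |u ^+ 2 + v ^+ 2| = t + 2 e]. *)
Lemma cnorm_le_scal x t : 0 <= t -> pos x -> pos (scal A t - x) -> cnorm x <= t.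
Proof.
move=> t0 px ptx; apply: (@ler_scaled_eps _ 3) => e e0.
have [u [sau uE cu]] := pos_sqrt px e0.
have [v [sav vE cv]] := pos_sqrt ptx e0.
have uv : GRing.comm u v.
  apply: commr_sym; apply: cv; apply: commr_sym; apply: commrB.
    exact/commr_sym/scal_comm.
  exact: cu.
have := cnorm_sqr_le_add sau sav uv.
rewrite -uE -vE addrACA [x + _]addrC subrK -!scalD cnorm_scal.
rewrite ger0_norm; last lra.
rewrite -cnorm_sqr // -uE => le.
rewrite -(addrK (scal A e) x) (le_trans (cnormB _ _)) // cnorm_scal gtr0_norm //.
lra.
Qed.

Lemma cnorm_mono x y : pos x -> pos (y - x) -> cnorm x <= cnorm y.
Proof.
move=> px pyx; apply: cnorm_le_scal => //; first exact: cnorm_ge0.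
rewrite -(subrKA y); apply: posD => //; apply: pos_scal_sub => //.
by rewrite -(subrK x y); apply: selfadjD; [exact: pos_selfadj|exact: pos_selfadj].
Qed.

(** Up to a small error [x * y] is [(x + e) * (y + e)], which is the square of the self-adjoint
    product of two commuting roots. *)
Lemma posM x y : pos x -> pos y -> GRing.comm x y -> pos (x * y).
Proof.
move=> px py xy; apply: pos_closed => d d0.
(* As [e <= 1], the error [e (x + y) + e ^+ 2] has norm at most [e * C]. *)
set C := cnorm x + cnorm y + 1.
have C0 : 0 < C by rewrite ltr_wpDl // addr_ge0 // cnorm_ge0.
set e := Num.min 1 (d / C).
have e0 : 0 < e by rewrite lt_min ltr01 divr_gt0.
have e1 : e <= 1 by rewrite ge_min lexx.
have eC : e * C <= d by rewrite -ler_pdivlMr // ge_min lexx orbT.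
have [u [sau uE cu]] := pos_sqrt px e0.
have [v [sav vE cv]] := pos_sqrt py e0.
have uv : GRing.comm u v by apply: commr_sym; apply: cv; apply: commr_sym; apply: cu.
have -> : x * y + scal A d = (u * v) ^+ 2 + (scal A d - (scal A e * (x + y) + scal A (e ^+ 2))).
  rewrite exprMn_comm // -uE -vE.
  have -> : (x + scal A e) * (y + scal A e) =
      x * y + (scal A e * (x + y) + scal A (e ^+ 2)).
    by rewrite mulrDl !mulrDr -(scal_comm e x) expr2 scalM -!addrA.
  by rewrite addrACA subrr addr0.
apply: posD.
  by apply: pos_sqr; apply: selfadjM.
apply: pos_scal_sub.
  apply: selfadjD (selfadj_scal _ _); apply: selfadj_scalM.
  by apply: selfadjD; exact: pos_selfadj.
rewrite (le_trans (cnormD _ _)) // cnorm_scalM cnorm_scal !ger0_norm ?sqr_ge0 ?(ltW e0) //.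
apply: le_trans eC; rewrite /C.
have := cnormD x y; nra.
Qed.

Lemma posX x n : pos x -> pos (x ^+ n).
Proof.
move=> px; elim: n => [|n IH].
  by rewrite expr0 -scal1; apply: pos_scal.
by rewrite exprS; apply: posM => //; exact: commrX.
Qed.

(** The product [(t - a) * (t + a) = t ^+ 2 - a ^+ 2] of commuting positive elements is positive, so
    [|a| ^+ 2 = |a ^+ 2| <= t ^+ 2]. *)
Lemma cnorm_le_abs a t : 0 <= t -> pos (scal A t - a) -> pos (scal A t + a) ->
  cnorm a <= t.
Proof.
move=> t0 pm pp.
have saa : selfadj a.
  rewrite -[a](addKr (scal A t)) addrC; apply: selfadjB (selfadj_scal _ _).
  exact: pos_selfadj.
rewrite -ler_sqr ?nnegrE ?cnorm_ge0 // -cnorm_sqr //.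
apply: cnorm_le_scal; rewrite ?sqr_ge0 //; first exact: pos_sqr.
have ta := scal_comm t a.
have -> : scal A (t ^+ 2) - a ^+ 2 = (scal A t - a) * (scal A t + a).
  by rewrite mulrDr !mulrBl -ta subrKA -scalM.
apply: posM => //.
apply: commrD; apply: commr_sym; apply: commrB => //; exact: commr_sym.
Qed.

End Positivity.

(** * Positivity of [b^* b] *)

(** Identities between polynomials in one element are proved by [ring] in the commutative [{poly R}]
    and carried to [A] by this morphism. *)
Definition ev (R : realType) (A : cstarAlgType R) (a : A) (p : {poly R}) : A :=
  horner_alg a (map_poly (real_complex R) p).

HB.instance Definition _ (R : realType) (A : cstarAlgType R) (a : A) :=
  GRing.RMorphism.copy (ev a) (horner_alg a \o map_poly (real_complex R)).

Section StarSquares.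
Variables (R : realType) (A : cstarAlgType R).
Implicit Types (a b c x y : A) (s t e : R).

Lemma evX a : ev a 'X = a.
Proof. by rewrite /ev map_polyX horner_algX. Qed.

Lemma evC a t : ev a t%:P = scal A t.
Proof. by rewrite /ev map_polyC horner_algC. Qed.

Definition evE := (fun a => rmorphD (ev a), fun a => rmorphN (ev a),
  fun a => rmorphM (ev a), fun a => rmorphXn (ev a), fun a => rmorph1 (ev a)).

(** The two elements are [star w * w] and [w * star w] for [w = c * (star c * c + t) = (c * star c +
    t) * c]. *)
Lemma cnorm_star_swap c t :
  cnorm ((star c * c + scal A t) * (star c * c) * (star c * c + scal A t)) =
  cnorm ((c * star c + scal A t) * (c * star c) * (c * star c + scal A t)).
Proof.
pose w := c * (star c * c + scal A t).
have wE : w = (c * star c + scal A t) * c.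
  by rewrite /w mulrDr mulrDl mulrA (scal_comm t c).
have -> : (star c * c + scal A t) * (star c * c) * (star c * c + scal A t) =
    star w * w.
  rewrite /w starM starD starM starK (selfadj_scal A t).
  by rewrite !mulrA.
have -> : (c * star c + scal A t) * (c * star c) * (c * star c + scal A t) =
    star (star w) * star w.
  rewrite starK wE starM starD starM starK (selfadj_scal A t).
  by rewrite !mulrA.
by rewrite !cnorm_starM cnorm_star.
Qed.

(** Put [k = star c * c], [l = c * star c] and [M = |k| = |l|]. The common norm in [cnorm_star_swap]
    at [t = M] is at most about [M ^+ 3] because [k <= e], and at least about [2 M ^+ 3] because
    [l >= - e]. This bounds [M] by a multiple of [e]. *)
Lemma cnorm_starM_small c e : 0 < e ->
  pos (scal A e - star c * c) -> pos (scal A e + c * star c) ->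
  cnorm (star c * c) <= 5 * e.
Proof.
move=> e0 pk pl; have swap := cnorm_star_swap c (cnorm (star c * c)).
set k := star c * c in pk swap *; set l := c * star c in pl swap.
set M := cnorm k in swap *.
have M0 : 0 <= M := cnorm_ge0 k.
have sak : selfadj k := selfadj_starM c.
have sal : selfadj l by rewrite /l -{1}(starK c); exact: selfadj_starM.
have lM : cnorm l = M.
  by rewrite /M /l -{1}(starK c) !cnorm_starM cnorm_star.
rewrite leNgt; apply/negP => Me.
have kM : cnorm (k + scal A M) <= M + e.
  apply: cnorm_le_scal; first lra.
  - by rewrite addrC -[k]opprK; apply: pos_scal_sub; [exact: selfadjN|rewrite cnormN].
  - by rewrite [M + e]addrC scalD [k + _]addrC [scal A e + _]addrC opprD addrACA subrr add0r.
have up : cnorm ((l + scal A M) * l * (l + scal A M)) <= (M + e) * M * (M + e).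
  rewrite -swap (le_trans (cnormM _ _)) // ler_pM ?cnorm_ge0 //.
  by rewrite (le_trans (cnormM _ _)) // ler_pM ?cnorm_ge0.
have low : (2 * M - e) * M ^+ 2 <= (M + e) * M * (M + e) + M ^+ 2 * e.
  have -> : (2 * M - e) * M ^+ 2 = cnorm (scal A (2 * M - e) * l ^+ 2).
    rewrite cnorm_scalM (cnorm_sqr sal) lM ger0_norm //; lra.
  apply: le_trans (_ : cnorm ((l + scal A M) * l * (l + scal A M)
    + scal A (M ^+ 2 * e)) <= _).
    apply: cnorm_mono.
      by apply: pos_scalM; [lra|exact: pos_sqr].
    (* The term [M ^+ 2 * e] was added to make the difference factor into commuting positive
       elements. *)
    have -> : (l + scal A M) * l * (l + scal A M) + scal A (M ^+ 2 * e)
        - scal A (2 * M - e) * l ^+ 2 =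
        (l ^+ 2 + scal A (M ^+ 2)) * (scal A e + l).
      have : ('X + M%:P) * 'X * ('X + M%:P) + (M ^+ 2 * e)%:P
        - (2 * M - e)%:P * 'X ^+ 2 = ('X ^+ 2 + (M ^+ 2)%:P) * (e%:P + 'X).
        ring.
      by move=> /(congr1 (ev l)); rewrite !evE /= !(evX, evC).
    apply: posM => //.
      by apply: posD; [exact: pos_sqr|apply: pos_scal; exact: sqr_ge0].
    apply: commrD; last first.
      by apply: commr_sym; apply: commrD; [exact: commrX|exact/commr_sym/scal_comm].
    exact/commr_sym/scal_comm.
  rewrite (le_trans (cnormD _ _)) // lerD // cnorm_scal ger0_norm //.
  by rewrite mulr_ge0 ?sqr_ge0 // ltW.
have Mgt0 : 0 < M by lra.
have {}low : (2 * M - e) * M <= (M + e) ^+ 2 + M * e.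
  by rewrite -(ler_pM2l Mgt0); apply: le_trans (le_trans _ low) _; lra.
(* By now [low] amounts to [M ^+ 2 <= 4 e M + e ^+ 2], which fails for [M > 5 e]. *)
have := mulr_gt0 (_ : 0 < M - 5 * e) Mgt0; have := mulr_gt0 (_ : 0 < M - 5 * e) e0.
rewrite subr_gt0 => /(_ Me) + /(_ Me); nra.
Qed.

(** The increment from [n] to [n + 1] is [(n + 1) y ^+ n (y - 1) ^+ 2]. The inequality serves to
    bound [(1 - y) y ^+ n] by [1 / (n + 1)]. *)
Lemma pos_bernoulli y n : pos y ->
  pos (scal A n%:R * y ^+ n.+1 - scal A n.+1%:R * y ^+ n + 1).
Proof.
move=> py; have say := pos_selfadj py.
elim: n => [|n IH].
  rewrite scal0 mul0r sub0r scal1 mul1r expr0 addNr -(scal0 A).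
  exact: pos_scal.
have -> : scal A n.+1%:R * y ^+ n.+2 - scal A n.+2%:R * y ^+ n.+1 + 1 =
    (scal A n%:R * y ^+ n.+1 - scal A n.+1%:R * y ^+ n + 1)
    + scal A n.+1%:R * (y ^+ n * (y - 1) ^+ 2).
  have : n.+1%:R%:P * 'X ^+ n.+2 - n.+2%:R%:P * 'X ^+ n.+1 + 1 =
    (n%:R%:P * 'X ^+ n.+1 - n.+1%:R%:P * 'X ^+ n + 1)
    + n.+1%:R%:P * ('X ^+ n * ('X - 1) ^+ 2) :> {poly R}.
    rewrite -!natr1 !polyCD polyC1 !exprS; ring.
  by move=> /(congr1 (ev y)); rewrite !evE /= !(evX, evC).
apply: posD => //; apply: pos_scalM => //; apply: posM; first exact: posX.
  by apply: pos_sqr; apply: selfadjB => //; exact: star1.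
apply: commr_sym; apply: commrX; apply: commr_sym; apply: commrX.
by apply: commrB => //; exact: commr1.
Qed.

(** The sum is half of [p ^+ 2 + q ^+ 2], with [p] and [q] self-adjoint, namely twice the real part
    and, up to sign, twice the imaginary part of [c]. *)
Lemma pos_starM_add c : pos (star c * c + c * star c).
Proof.
pose p := c + star c; pose q := Complex 0 1 *: (c - star c) : A.
have -> : star c * c + c * star c = scal A 2^-1 * (p ^+ 2 + q ^+ 2).
  have -> : q ^+ 2 = - (c - star c) ^+ 2.
    by rewrite expr2 -scalerAl -scalerAr scalerA -expr2 sqr_i scaleN1r -expr2.
  have -> : p ^+ 2 = (c ^+ 2 + star c ^+ 2) + (star c * c + c * star c).
    by rewrite /p !expr2 mulrDr !mulrDl [c * star c + _]addrC addrACA.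
  have -> : (c - star c) ^+ 2 =
      (c ^+ 2 + star c ^+ 2) - (star c * c + c * star c).
    by rewrite !expr2 mulrBr !mulrBl opprB addrACA -opprD.
  by rewrite opprB [X in _ = _ * X]addrC subrKA -scal2M mulrA -scalM mulVf ?scal1 ?mul1r.
apply: pos_scalM; first by rewrite invr_ge0.
apply: posD; apply: pos_sqr; first by rewrite /selfadj starD starK addrC.
by rewrite /selfadj starZi starB starK -scalerN opprB.
Qed.

(** For [|b| <= 1], put [h = star b * b], [y = 1 - h] and [c = b y ^+ n]. Then
    [star c * c = h y ^+ (2 n)] lies below [d = 1 / (2 n + 1)], so its norm is at most [5 d] by
    [cnorm_starM_small]. As [h - h y ^+ (2 n)] is positive, [h + 5 d] is positive, and [n] is
    arbitrary. *)
Lemma pos_starM b : pos (star b * b).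
Proof.
wlog b1 : b / cnorm b <= 1 => [small|].
  have s0 : 0 < cnorm b + 1 by rewrite ltr_wpDl // cnorm_ge0.
  have : pos (star (scal A (cnorm b + 1)^-1 * b) * (scal A (cnorm b + 1)^-1 * b)).
    apply: small; rewrite cnorm_scalM gtr0_norm ?invr_gt0 // mulrC ler_pdivrMr //.
    by rewrite mul1r lerDl.
  move=> /(pos_scalM (sqr_ge0 (cnorm b + 1))).
  have scaleE r : star (scal A r * b) * (scal A r * b) =
      scal A (r ^+ 2) * (star b * b).
    rewrite starM (selfadj_scal A r) -(scal_comm r (star b)) -!mulrA.
    rewrite [star b * (_ * _)]mulrA -(scal_comm r (star b)) -mulrA mulrA.
    by rewrite -scalM.
  by rewrite scaleE mulrA -scalM -exprMn mulfV ?gt_eqF // expr1n scal1 mul1r.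
set h := star b * b; set y := 1 - h.
have sah : selfadj h := selfadj_starM b.
have h1 : cnorm h <= 1 by rewrite cnorm_starM expr_le1 // cnorm_ge0.
have py : pos y by rewrite /y -scal1; exact: pos_scal_sub.
have say := pos_selfadj py.
have hE : h = 1 - y by rewrite /y opprB addrCA subrr addr0.
have hy n : GRing.comm h (y ^+ n).
  by apply: commrX; apply: commrB => //; exact: commr1.
have mono n : pos (h - h * y ^+ n).
  elim: n => [|n IH].
    by rewrite expr0 mulr1 subrr -(scal0 A); exact: pos_scal.
  have -> : h - h * y ^+ n.+1 = (h - h * y ^+ n) + h ^+ 2 * y ^+ n.
    have : (1 - 'X) - (1 - 'X) * 'X ^+ n.+1 =
      ((1 - 'X) - (1 - 'X) * 'X ^+ n) + (1 - 'X) ^+ 2 * 'X ^+ n :> {poly R} by rewrite exprS; ring.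
    by move=> /(congr1 (ev y)); rewrite !evE /= !(evX, evC) -hE.
  apply: posD => //; apply: posM; [exact: pos_sqr|exact: posX|].
  by apply: commr_sym; apply: commrX; exact: commr_sym.
have upper N (d : R := N.+1%:R^-1) : scal A d - h * y ^+ N = scal A d *
    ((scal A N%:R * y ^+ N.+1 - scal A N.+1%:R * y ^+ N + 1) + y ^+ N.+1).
  have : d%:P - (1 - 'X) * 'X ^+ N = d%:P *
    ((N%:R%:P * 'X ^+ N.+1 - N.+1%:R%:P * 'X ^+ N + 1) + 'X ^+ N.+1) :> {poly R}.
    have dn : d%:P * N.+1%:R%:P = 1 :> {poly R} by rewrite -polyCM mulVf.
    rewrite -natr1 polyCD polyC1 mulrDr mulr1 in dn *.
    transitivity ((d%:P * N%:R%:P + d%:P) * ('X ^+ N.+1 - 'X ^+ N) + d%:P).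
      by rewrite dn !exprS; ring.
    by rewrite !exprS; ring.
  by move=> /(congr1 (ev y)); rewrite !evE /= !(evX, evC) -hE.
apply: pos_closed => e e0.
(* Chosen so that [5 d <= e], where [d] is the bound that [upper] gives for the exponent [2 n]. *)
pose n := Num.bound (5 / e).
pose d : R := (n.*2.+1)%:R^-1.
have d0 : 0 < d by rewrite invr_gt0.
have de : 5 * d <= e.
  rewrite ler_pdivrMr // -ler_pdivrMl // mulrC.
  apply: le_trans (ltW (archi_boundP _)) _; first by rewrite divr_ge0 // ltW.
  by rewrite ler_nat -addnn -addSn leq_addl.
pose c := b * y ^+ n.
have cE : star c * c = h * y ^+ n.*2.
  rewrite /c starM (selfadjX n say) -addnn exprD [in RHS]mulrA (hy n).
  by rewrite !mulrA.
have pk : pos (scal A d - star c * c).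
  rewrite cE upper.
  apply: pos_scalM (ltW d0) _; apply: posD; [exact: pos_bernoulli|exact: posX].
have small : cnorm (star c * c) <= 5 * d.
  apply: cnorm_starM_small => //.
  (* Here [d + c * star c] is split as [d - star c * c] plus [star c * c + c * star c]. *)
  by rewrite -(subrKA (star c * c)); apply: posD => //; exact: pos_starM_add.
have -> : h + scal A e = (h - h * y ^+ n.*2) + (scal A e - - (star c * c)).
  by rewrite cE opprK addrA addrAC subrK.
apply: posD => //; apply: pos_scal_sub.
  by apply: selfadjN; exact: selfadj_starM.
by rewrite cnormN (le_trans small).
Qed.

End StarSquares.

(** * The Hahn-Banach theorem *)

Section HahnBanach.
Variables (R : realType) (V : lmodType R).
Implicit Types (x y a : V) (p q : V -> R).

Definition sublinear q :=
  (forall x y, q (x + y) <= q x + q y) /\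
  (forall (r : R) x, 0 < r -> q (r *: x) = r * q x).

Lemma sublinear0 q : sublinear q -> q 0 = 0.
Proof. by move=> [_ /(_ 2 0 (ltr0n _ 2))]; rewrite scaler0; lra. Qed.

Lemma sublinear_opp q x : sublinear q -> - q (- x) <= q x.
Proof.
by move=> sq; have := sq.1 x (- x); rewrite subrr sublinear0 //; lra.
Qed.

(** One criterion for two infima: over a half-line in [sublinear_decr] and over a chain in
    [sublinear_minimal]. One inequality suffices for homogeneity, the other being its instance at
    [r^-1]. *)
Lemma sublinear_inf (S : V -> set R) :
  (forall x, has_inf (S x)) ->
  (forall x y s t, S x s -> S y t -> exists2 u, S (x + y) u & u <= s + t) ->
  (forall (r : R) x s, 0 < r -> S x s -> exists2 u, S (r *: x) u & u <= r * s) ->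
  sublinear (fun x => inf (S x)).
Proof.
move=> infS SD SZ.
have infle x s : S x s -> inf (S x) <= s by apply: ge_inf; exact: (infS x).2.
have scale_le (r : R) x : 0 < r -> inf (S (r *: x)) <= r * inf (S x).
  move=> r0; rewrite mulrC -ler_pdivrMr //; apply: lb_le_inf; first exact: (infS x).1.
  move=> s /(SZ r _ _ r0)[u /infle le us].
  by rewrite ler_pdivrMr // mulrC (le_trans le).
split=> [x y|r x r0].
  apply: (@ler_scaled_eps _ 2) => e e0.
  have [s Ss sx] := inf_adherent e0 (infS x).
  have [t St ty] := inf_adherent e0 (infS y).
  have [u /infle le ust] := SD _ _ _ _ Ss St; lra.
apply/eqP; rewrite eq_le scale_le //= -ler_pdivlMl // .
apply: le_trans (scale_le r^-1 (r *: x) _); last by rewrite invr_gt0.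
by rewrite scalerA mulVf ?gt_eqF // scale1r.
Qed.

(** Take [q' x] to be the infimum of [q (x + t a) - t q a] over [t >= 0], which is bounded below by
    [- q (- x)]. The value [t = 0] gives [q' <= q], and [t = 1] gives the bound at [- a]. *)
Lemma sublinear_decr q a : sublinear q ->
  exists q', [/\ sublinear q', forall x, q' x <= q x & q' (- a) <= - q a].
Proof.
move=> sq.
pose S x := [set q (x + t *: a) - t * q a | t in [set t : R | 0 <= t]].
have scale0 (t : R) : 0 <= t -> t * q a = q (t *: a).
  rewrite le_eqVlt => /orP[/eqP <-|t0]; first by rewrite mul0r scale0r sublinear0.
  by rewrite sq.2.
have infS x : has_inf (S x).
  split; first by exists (q (x + 0 *: a) - 0 * q a), 0 => /=.
  exists (- q (- x)) => _ [t /= t0 <-]; rewrite scale0 //.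
  have := sq.1 (x + t *: a) (- x); rewrite addrAC subrr add0r; lra.
have le x s : S x s -> inf (S x) <= s by apply: ge_inf; exact: (infS x).2.
exists (fun x => inf (S x)); split.
- apply: sublinear_inf => //.
    move=> x y _ _ [s s0 <-] [t t0 <-]; exists (q (x + y + (s + t) *: a) - (s + t) * q a).
      by exists (s + t) => //=; rewrite addr_ge0.
    rewrite scalerDl addrACA; have := sq.1 (x + s *: a) (y + t *: a); lra.
  move=> r x _ r0 [s /= s0 <-].
  exists (q (r *: x + (r * s) *: a) - (r * s) * q a).
    by exists (r * s) => //=; rewrite mulr_ge0 // ltW.
  by rewrite -scalerA -scalerDr sq.2 // mulrBr mulrA.
- by move=> x; apply: le; exists 0 => //=; rewrite scale0r addr0 mul0r subr0.
- apply: le; exists 1 => //=.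
  by rewrite scale1r addNr sublinear0 // mul1r sub0r.
Qed.

Lemma sublinear_minimal p : sublinear p ->
  exists q, [/\ sublinear q, forall x, q x <= p x &
    forall q', sublinear q' -> (forall x, q' x <= q x) -> forall x, q x <= q' x].
Proof.
move=> sp; pose P q := sublinear q /\ forall x, q x <= p x.
pose T := {q : V -> R | P q}.
(* The order is reversed, so that a maximal element for Zorn's lemma is a minimal functional. Chains
   are bounded by their pointwise infimum, finite because it is at least [- p (- x)]. *)
pose le (s t : T) := `[< forall x, sval t x <= sval s x >].
pose t0 : T := exist _ p (conj sp (fun x => lexx (p x))).
have [|||[q [sq qp]] qmin] := @ZL_preorder T t0 le.
- by move=> t; apply/asboolP.
- move=> r s t /asboolP rs /asboolP st; apply/asboolP => x.
  exact: le_trans (rs x).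
- move=> C Ctot; have [[c0 Cc0]|C0] := pselect (C !=set0); last first.
    by exists t0 => s Cs; case: C0; exists s.
  pose S x := [set sval c x | c in C].
  have infS x : has_inf (S x).
    split; first by exists (sval c0 x), c0.
    exists (- p (- x)) => _ [[c [sc cp]] _ <-] /=.
    by apply: le_trans (sublinear_opp x sc); rewrite lerN2.
  have infle x c : C c -> inf (S x) <= sval c x.
    by move=> Cc; apply: ge_inf; [exact: (infS x).2|exists c].
  have sinf : sublinear (fun x => inf (S x)).
    apply: sublinear_inf => //.
      move=> x y _ _ [c Cc <-] [d Cd <-].
      have [/asboolP cd|/asboolP dc] := Ctot _ _ Cc Cd.
        exists (sval d (x + y)); first by exists d.
        by apply: le_trans ((svalP d).1.1 x y) _; rewrite lerD2r.
      exists (sval c (x + y)); first by exists c.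
      by apply: le_trans ((svalP c).1.1 x y) _; rewrite lerD2l.
    move=> r x _ r0 [c Cc <-]; exists (sval c (r *: x)); first by exists c.
    by rewrite (svalP c).1.2.
  have infp x : inf (S x) <= p x.
    by apply: le_trans (infle x _ Cc0) _; exact: (svalP c0).2.
  exists (exist P (fun x => inf (S x)) (conj sinf infp)) => s Cs; apply/asboolP => x.
  exact: infle.
exists q; split => // q' sq' q'q.
have q'p x : q' x <= p x by exact: le_trans (qp x).
have /qmin/asboolP : le (exist P q (conj sq qp)) (exist P q' (conj sq' q'p)).
  by apply/asboolP.
exact.
Qed.

(* A minimal sublinear functional is odd, because [sublinear_decr] cannot
   decrease it, and an odd sublinear functional is linear. *)
Lemma sublinear_ge_linear p : sublinear p ->
  exists g : {linear V -> R^o}, forall x, g x <= p x.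
Proof.
move=> sp; have [q [sq qp qmin]] := sublinear_minimal sp.
have qN a : q (- a) = - q a.
  have [q' [sq' q'q q'a]] := sublinear_decr a sq.
  apply/eqP; rewrite eq_le (le_trans (qmin _ sq' q'q _) q'a) /=.
  by have := sublinear_opp (- a) sq; rewrite opprK.
have lin : linear (q : V -> R^o).
  have qD x y : q (x + y) = q x + q y.
    apply/eqP; rewrite eq_le sq.1 /=.
    have := sq.1 (x + y) (- y); rewrite addrK qN; lra.
  move=> r x y; rewrite qD; congr (_ + _).
  have [r0|r0|->] := ltrgtP r 0; last by rewrite !scale0r sublinear0.
    rewrite -[r]opprK scaleNr qN sq.2 ?oppr_gt0 // scaleNr //.
  by rewrite sq.2.
pose g : {linear V -> R^o} := HB.pack (q : V -> R^o) (GRing.isLinear.Build _ _ _ _ _ lin).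
by exists g => x; exact: qp.
Qed.

End HahnBanach.

(** Decreasing the norm at [- e] down to [- |e|] forces every linear functional below it to take at
    least the value [|e|] at [e]. *)
Lemma norming_functional (R : realType) (V : normedModType R) (e : V) :
  exists2 g : {linear V -> R^o}, (forall x, `|g x| <= `|x|) & g e = `|e|.
Proof.
have sn : sublinear (fun x : V => `|x|).
  by split=> [x y|r x r0]; [exact: ler_normD|rewrite normrZ gtr0_norm].
have [p [sp pn pe]] := sublinear_decr e sn.
have [g gp] := sublinear_ge_linear sp.
have gn x : g x <= `|x| by exact: le_trans (gp x) (pn x).
exists g => [x|].
  by rewrite ler_norml gn andbT lerNl -linearN -(normrN x).
apply/eqP; rewrite eq_le gn /= -lerN2 -[leLHS]linearN.
exact: le_trans (gp _) pe.
Qed.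

(** * States *)

Section States.
Variables (R : realType) (A : cstarAlgType R).
Implicit Types (a b c x y : A) (s t e : R).

Local Notation imag := (Complex (0 : R) 1).

Definition repart a : A := scal A 2^-1 * (a + star a).
Definition impart a : A := repart (- (imag *: a)).

Lemma selfadj_repart a : selfadj (repart a).
Proof. by apply: selfadj_scalM; rewrite /selfadj starD starK addrC. Qed.

Lemma cnorm_imag a : cnorm (imag *: a) = cnorm a.
Proof. by rewrite cnormZ /Normc.normc /= expr0n expr1n add0r sqrtr1 mul1r. Qed.

Lemma repartK a : repart a + imag *: impart a = a.
Proof.
rewrite /impart /repart starN starZi opprK scalerAr -mulrDr scalerDr scalerN !scalerA.
rewrite -[imag * imag]/('i%C ^+ 2) sqr_i !scaleN1r opprK.
by rewrite addrACA subrr addr0 -scal2M mulrA -scalM mulVf // scal1 mul1r.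
Qed.

Lemma repart_selfadj a : selfadj a -> repart a = a.
Proof.
by rewrite /repart => ->; rewrite -scal2M mulrA -scalM mulVf // scal1 mul1r.
Qed.

Lemma repart_imag a : selfadj a -> repart (imag *: a) = 0.
Proof. by rewrite /repart starZi => ->; rewrite subrr mulr0. Qed.

Lemma repartD a b : repart (a + b) = repart a + repart b.
Proof. by rewrite /repart starD addrACA mulrDr. Qed.

Lemma repart_scalM t a : repart (scal A t * a) = scal A t * repart a.
Proof.
rewrite /repart starM (selfadj_scal A t) -(scal_comm t) -mulrDr !mulrA.
by rewrite (scal_comm (2^-1)).
Qed.

Lemma cnorm_repart a : cnorm (repart a) <= cnorm a.
Proof.
rewrite cnorm_scalM gtr0_norm ?invr_gt0 // mulrC ler_pdivrMr //.
by rewrite mulr_natr mulr2n (le_trans (cnormD _ _)) // cnorm_star.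
Qed.

Lemma cnorm_impart a : cnorm (impart a) <= cnorm a.
Proof. by rewrite (le_trans (cnorm_repart _)) // cnormN cnorm_imag. Qed.

Section StateBounds.
Variables (phi : A -> R[i]) (st : is_state phi).

Lemma stateD a b : phi (a + b) = phi a + phi b.
Proof. by case: st => lin _ _; rewrite -[a]scale1r lin mul1r scale1r. Qed.

Lemma stateZ k a : phi (k *: a) = k * phi a.
Proof.
case: st => lin _ _; have phi0 : phi 0 = 0.
  by apply: (addrI (phi 0)); rewrite -stateD !addr0.
by rewrite -[k *: a]addr0 lin phi0 addr0.
Qed.

Lemma stateN a : phi (- a) = - phi a.
Proof. by rewrite -scaleN1r stateZ mulN1r. Qed.

Lemma state_scal t : phi (scal A t) = real_complex R t.
Proof. by rewrite stateZ; case: st => _ _ ->; rewrite mulr1. Qed.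

(** For [t > |a|] both [t - a] and [t + a] are squares of self-adjoint elements, so [phi] is
    nonnegative on them. *)
Lemma state_selfadj a : selfadj a ->
  exists2 r : R, phi a = real_complex R r & `|r| <= cnorm a.
Proof.
have le b t : selfadj b -> cnorm b < t -> phi b <= real_complex R t.
  move=> sab bt; have [||u [sau uE _]] := @sqrt_exists _ _ (scal A t - b) t.
  - by apply: selfadjB => //; exact: selfadj_scal.
  - by rewrite opprB addrCA subrr addr0.
  case: (st) => _ /(_ u); rewrite sau -expr2 -uE stateD stateN state_scal => + _.
  by rewrite subr_ge0.
move=> saa; have le1 t : cnorm a < t -> phi a <= real_complex R t by exact: le.
have le2 t : cnorm a < t -> - phi a <= real_complex R t.
  by rewrite -stateN -cnormN; apply: le; exact: selfadjN.
move: (le1) (le2); case: (phi a) => r i {}le1 {}le2.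
(* Comparability with a real number in [R[i]] forces equal imaginary parts. *)
have /eqP i0 : i == 0.
  have := le1 (cnorm a + 1); rewrite ltrDl ltr01 lecE /= => /(_ isT)/andP[/eqP <- _].
  by [].
exists r; first by rewrite i0.
apply/ler_addgt0Pr => e e0; rewrite ler_norml.
have ae : cnorm a < cnorm a + e by rewrite ltrDl.
have := le1 _ ae; have := le2 _ ae; rewrite !lecE /= => /andP[_ +] /andP[_].
by move=> ? ?; apply/andP; split; lra.
Qed.

(** The factor 2 comes from estimating the real and imaginary parts of [a] separately. *)
Lemma state_bound a : Normc.normc (phi a) <= 2 * cnorm a.
Proof.
rewrite -{1}(repartK a) stateD stateZ.
have [r -> rle] := state_selfadj (selfadj_repart a).
have [s -> sle] := state_selfadj (selfadj_repart (- (imag *: a))).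
rewrite (le_trans (le_normcD _ _)) // Normc.normcM.
rewrite /Normc.normc /= !expr0n expr1n !addr0 add0r sqrtr1 mul1r !sqrtr_sqr.
have := cnorm_repart a; have := cnorm_impart a; rewrite /impart; lra.
Qed.

End StateBounds.

Local Notation V := (normed_copy A).

(** From [|g (|x| - x)| <= |x|] and [g |x| = |x|] it follows that [|x| - g x <= |x|]. *)
Lemma functional_pos (g : {linear V -> R^o}) x :
  (forall y : V, `|g y| <= `|y|) -> g (1 : A) = 1 -> pos x -> 0 <= g x.
Proof.
move=> gn g1 px.
have := gn (scal A (cnorm x) - x); rewrite linearB /=.
have -> : g (scal A (cnorm x)) = cnorm x.
  by rewrite -[RHS]mulr1 -g1; exact: (linearZ_LR g (cnorm x) (1 : A)).
have : cnorm (scal A (cnorm x) - x) <= cnorm x by exact: pos_cnorm_sub.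
move=> n1 n2; have := le_trans (ler_norm _) (le_trans n2 n1); lra.
Qed.

(** Complexification: [phi a = G a - i G (i a)], where [G] is [g] composed with the real part, so
    that [phi] is real on self-adjoint elements. Its positivity rests on [pos_starM]. *)
Lemma functional_state (g : {linear V -> R^o}) :
  (forall y : V, `|g y| <= `|y|) -> g (1 : A) = 1 ->
  exists2 phi : A -> R[i], is_state phi &
    forall a, selfadj a -> phi a = Complex (g a) 0.
Proof.
move=> gn g1; pose G a : R := g (repart a).
have GD a b : G (a + b) = G a + G b.
  by rewrite /G repartD; exact: (linearD g).
have GZ t a : G (scal A t * a) = t * G a.
  by rewrite /G repart_scalM -scalZ; exact: (linearZ_LR g t (repart a)).
pose phi a := Complex (G a) (- G (imag *: a)).
have phisa a : selfadj a -> phi a = Complex (g a) 0.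
  by move=> saa; rewrite /phi /G repart_selfadj // repart_imag // linear0 oppr0.
exists phi => //; split.
- have kE (s t : R) a : Complex s t *: a = scal A s * a + scal A t * (imag *: a).
    rewrite -!scalZ scalerA -scalerDl; congr (_ *: _).
    by apply/eqP; rewrite eq_complex /= !mulr0 !mul0r !mulr1 subr0 !addr0 add0r !eqxx.
  move=> [s t] a b; rewrite /phi.
  have -> : imag *: (Complex s t *: a + b) =
      Complex s t *: (imag *: a) + imag *: b.
    by rewrite scalerDr !scalerA [imag * _]mulrC.
  rewrite !GD (kE s t a) (kE s t (imag *: a)) !GD !GZ scalerA.
  rewrite -[imag * imag]/('i%C ^+ 2) sqr_i scaleN1r.
  have -> : G (- a) = - G a.
    apply: (addrI (G a)); rewrite -GD !subrr /G /repart star0 addr0 mulr0.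
    by rewrite linear0.
  by apply/eqP; rewrite eq_complex /=; apply/andP; split; apply/eqP; ring.
- move=> a; rewrite phisa; last exact: selfadj_starM.
  by rewrite lecE /= eqxx functional_pos //; exact: pos_starM.
- by rewrite phisa ?g1 //; exact: star1.
Qed.

Lemma normc_opp (z : R[i]) : Normc.normc (- z) = Normc.normc z.
Proof. by case: z => r i /=; rewrite !sqrrN. Qed.

(** If [|1 + a| >= 1 + |a|], a norming functional [g] of [1 + a] has [g 1 <= 1] and [g a <= |a|]
    with sum at least [1 + |a|], so both are equalities and [g] yields a state. Otherwise the same
    holds for [- a], or else both [1 + a] and [1 - a] have norm at most some [m < 1 + |a|], and then
    [|a| <= m - 1], a contradiction. *)
Lemma norming_state a : selfadj a ->
  exists2 phi : A -> R[i], is_state phi & Normc.normc (phi a) = cnorm a.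
Proof.
wlog large : a / 1 + cnorm a <= cnorm (1 + a) => [wl|] saa.
  have [|small1] := leP (1 + cnorm a) (cnorm (1 + a)); first by move=> ?; exact: wl.
  have [|small2] := leP (1 + cnorm a) (cnorm (1 - a)).
    move=> big; have [||phi st phia] := wl (- a); rewrite ?cnormN //.
      exact: selfadjN.
    by exists phi => //; rewrite -(cnormN a) -phia stateN // normc_opp.
  set m := Num.max (cnorm (1 + a)) (cnorm (1 - a)).
  have m1 : cnorm (1 + a) <= m by rewrite le_max lexx.
  have m2 : cnorm (1 - a) <= m by rewrite le_max lexx orbT.
  have mlt : m < 1 + cnorm a by rewrite gt_max small1.
  have : cnorm a <= m - 1.
    apply: cnorm_le_abs.
    (* This gives [m >= 1], since the two terms add up to 2. *)
    - have : cnorm ((1 + a) + (1 - a)) <= m + m.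
        by rewrite (le_trans (cnormD _ _)) // lerD.
      rewrite addrACA subrr addr0 -scal2M mulr1 cnorm_scal ger0_norm //; lra.
    - rewrite scalB scal1 -addrA -opprD; apply: pos_scal_sub => //.
      by apply: selfadjD => //; exact: star1.
    - rewrite scalB scal1 -addrA -[_ + a]opprK opprD opprK; apply: pos_scal_sub => //.
      by apply: selfadjB => //; exact: star1.
  lra.
have [g gn ge] := norming_functional (1 + a : V).
have g1 : g (1 : A) <= 1.
  by rewrite (le_trans (ler_norm _)) // (le_trans (gn _)) // -[leRHS](cnorm1 A).
have ga : g a <= cnorm a by rewrite (le_trans (ler_norm _)) // (gn (a : V)).
have {}ge : g (1 : A) + g a = cnorm (1 + a) by exact: etrans (esym (linearD g (1 : A) a)) ge.
have [|phi st phia] := functional_state gn; first lra.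
exists phi => //; rewrite phia // /Normc.normc /= expr0n addr0 sqrtr_sqr.
have -> : g a = cnorm a by lra.
by rewrite ger0_norm // cnorm_ge0.
Qed.

End States.

(** * The diameter of the state space *)

Section Diameter.
Variables (R : realType) (A : cstarAlgType R).
Implicit Types (a b : A) (phi psi : states A) (t : R).

Lemma state_funP phi : is_state (state_fun phi).
Proof. exact: (set_valP phi). Qed.

Lemma mix_is_state phi psi t : 0 <= t <= 1 ->
  is_state (fun a => real_complex R (1 - t) * state_fun phi a
                     + real_complex R t * state_fun psi a).
Proof.
move=> /andP[t0 t1]; have sp := state_funP phi; have sq := state_funP psi.
split=> [k a b|a|].
- rewrite !stateD // !stateZ // !mulrDr; rewrite addrACA; congr (_ + _).
  by rewrite mulrCA; congr (_ + _); rewrite mulrCA.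
- case: sp => _ p0 _; case: sq => _ q0 _.
  by rewrite addr_ge0 // mulr_ge0 // lecR // subr_ge0.
- case: sp => _ _ ->; case: sq => _ _ ->.
  by rewrite !mulr1 -rmorphD subrK rmorph1.
Qed.

Definition mix phi psi t (t01 : 0 <= t <= 1) : states A :=
  exist _ (_ : {ptws A -> R[i]^o}) (mem_set (mix_is_state phi psi t01)).

Lemma state_fun_mix phi psi t (t01 : 0 <= t <= 1) a :
  state_fun phi a - state_fun (mix phi psi t01) a =
  real_complex R t * (state_fun phi a - state_fun psi a).
Proof.
rewrite [state_fun (mix _ _ _)]/state_fun set_valE /= rmorphB rmorph1.
by ring.
Qed.

Lemma normc_real t : Normc.normc (real_complex R t) = `|t|.
Proof. by rewrite /Normc.normc /= expr0n addr0 sqrtr_sqr. Qed.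

Lemma state_dist_bound phi psi a :
  Normc.normc (state_fun phi a - state_fun psi a) <= 4 * cnorm a.
Proof.
rewrite (le_trans (le_normcD _ _)) // normc_opp.
have := state_bound (state_funP phi) a.
have := state_bound (state_funP psi) a; lra.
Qed.

(** The parameter [t] is uniform in [psi] because state values at each [a] are uniformly bounded. If
    no [t = 1 / (n + 1)] worked, mixtures with these parameters would stay outside [U] and yet
    converge pointwise to [phi]. *)
Lemma open_states_mix (U : set (states A)) phi : open U -> U phi ->
  exists2 t, 0 < t & forall psi, exists t01 : 0 <= t <= 1, U (mix phi psi t01).
Proof.
move=> Uop Uphi; apply: contrapT => noU.
have t01 n : 0 <= (n.+1%:R^-1 : R) <= 1.
  by rewrite invr_ge0 ler0n /= invf_le1 ?ltr0n // ler1n.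
have /choice[u Uu] n : exists psi, ~ U (mix phi psi (t01 n)).
  apply/not_existsP => allU; apply: noU; exists n.+1%:R^-1 => // psi.
  by exists (t01 n); exact: contrapT.
case: (Uop) => B Bop BU.
pose v n : {ptws A -> R[i]^o} := set_val (mix phi (u n) (t01 n)).
have vphi : v @ \oo --> (set_val phi : {ptws A -> R[i]^o}).
  apply/(@pointwise_cvgP (normed_copy A) R[i]^o) => a.
  change ((fun n => state_fun (mix phi (u n) (t01 n)) a : R[i]^o) @ \oo -->
    (state_fun phi a : R[i]^o)).
  apply/cvgrPdist_lt => e; rewrite ltcE /= => /andP[/eqP ei e0].
  have K0 : 0 <= 4 * cnorm a by rewrite mulr_ge0 // cnorm_ge0.
  exists (Num.bound (4 * cnorm a / complex.Re e)) => // n /= Nn.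
  have normE (z : R[i]) : `|z : R[i]^o| = real_complex R (Normc.normc z) by [].
  rewrite normE state_fun_mix.
  rewrite ltcE /= ei eqxx /= Normc.normcM.
  rewrite normc_real ger0_norm ?invr_ge0 // mulrC ltr_pdivrMr ?ltr0n //.
  apply: le_lt_trans (state_dist_bound _ _ _) _.
  rewrite [ltRHS]mulrC -ltr_pdivrMr //.
  apply: lt_le_trans (archi_boundP _) _; first exact: divr_ge0 K0 (ltW e0).
  by rewrite ler_nat leqW.
have [N _ NB] : \forall n \near \oo, B (v n).
  apply: vphi; apply: open_nbhs_nbhs; split => //.
  by move: Uphi; rewrite -BU.
apply: (Uu N); rewrite -BU; exact: NB N (leqnn N).
Qed.

Variable L : A -> \bar R.

Lemma lip_dist_ge phi psi a : (L a <= 1)%E ->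
  ((Normc.normc (state_fun phi a - state_fun psi a))%:E <= lip_dist L phi psi)%E.
Proof. by move=> La; apply: ereal_sup_ubound; exists a. Qed.

Lemma lip_dist_le phi psi (C : \bar R) :
  (forall a, (L a <= 1)%E ->
    ((Normc.normc (state_fun phi a - state_fun psi a))%:E <= C)%E) ->
  (lip_dist L phi psi <= C)%E.
Proof. by move=> le; apply: ge_ereal_sup => _ [a La <-]; exact: le. Qed.

Lemma lip_dist_triangle phi psi chi :
  (lip_dist L phi chi <= lip_dist L phi psi + lip_dist L psi chi)%E.
Proof.
apply: lip_dist_le => a La.
apply: le_trans (leeD (lip_dist_ge phi psi La) (lip_dist_ge psi chi La)).
rewrite -EFinD lee_fin -(subrKA (state_fun psi a)).
exact: le_normcD.
Qed.

(* The segments from [phi] to all other states enter the open unit ball around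
   [phi] at a common parameter [t], and the distance is linear along them. *)
Lemma lip_dist_bounded phi : L 1 = 0%E -> induces_weak_star (lip_dist L) ->
  exists2 D : R, 0 < D & forall psi a, (L a <= 1)%E ->
    Normc.normc (state_fun phi a - state_fun psi a) <= D.
Proof.
move=> L1 weak; pose U := [set psi | (lip_dist L phi psi < 1)%E].
have Uop : open U.
  apply/weak => psi /= ltpsi.
  have d0 : (0 <= lip_dist L phi psi)%E.
    (* The unit is a test element for the supremum, because [L 1 = 0]. *)
    apply: le_trans (lip_dist_ge phi psi (_ : (L 1%R <= 1)%E)); last by rewrite L1.
    by rewrite lee_fin; case: (_ - _) => r i; exact: sqrtr_ge0.
  have dfin : lip_dist L phi psi \is a fin_num.
    by rewrite ge0_fin_numE // (lt_trans ltpsi) // ltry.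
  exists (1 - fine (lip_dist L phi psi)) => [|chi /= ltchi].
    by rewrite subr_gt0 -lte_fin fineK.
  apply: le_lt_trans (lip_dist_triangle phi psi chi) _.
  rewrite -[X in (X + _)%E]fineK //.
  by rewrite -lteBrDl // -EFinB.
have Uphi : U phi.
  have d0 : (lip_dist L phi phi <= 0)%E.
    apply: lip_dist_le => a _; rewrite subrr lee_fin.
    by rewrite /Normc.normc /= expr0n addr0 sqrtr0.
  by rewrite /U /= (le_lt_trans d0) // lte_fin ltr01.
have [t t0 Ut] := open_states_mix Uop Uphi.
exists t^-1 => [|psi a La]; first by rewrite invr_gt0.
have [t01 /= lt1] := Ut psi.
have := le_lt_trans (lip_dist_ge phi (mix phi psi t01) La) lt1.
rewrite lte_fin state_fun_mix Normc.normcM normc_real gtr0_norm // => lt.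
by rewrite -[t^-1]mul1r ler_pdivlMr // mulrC ltW.
Qed.

End Diameter.

(** * Lower semicontinuous seminorms on closed convex sets *)

Section BoundedOnConvex.
Variables (R : realType) (V : completeNormedModType R).
Variables (K : set V) (q : V -> \bar R).
Hypothesis Kclosed : closed K.
Hypothesis Kconvex : forall x y (t : R), K x -> K y -> 0 <= t <= 1 ->
  K ((1 - t) *: x + t *: y).
Hypothesis Kbounded : forall x, K x -> `|x| <= 1.
Hypothesis q_ge0 : forall x, (0 <= q x)%E.
Hypothesis qD : forall x y, (q (x + y)%R <= q x + q y)%E.
Hypothesis qZ : forall (t : R) x, q (t *: x) = (`|t|%:E * q x)%E.
Hypothesis q_lsc : forall s : R, 0 < s -> closed [set x | (q x <= s%:E)%E].
Hypothesis q_fin : forall x, K x -> (q x < +oo)%E.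

(** Move from [a] a short way [t] towards a point [x] where [q] is huge. The point reached is within
    [2 t] of [a], and subadditivity bounds [t q x] by its value plus [q a]. *)
Let large_near (unbounded : forall C : R, exists2 x, K x & (C%:E < q x)%E)
    a (e s : R) : K a -> 0 < e -> 0 < s ->
  exists2 b, K b & `|b - a| < e /\ (s%:E < q b)%E.
Proof.
move=> Ka e0 s0; pose t := Num.min 1 (e / 4).
have t0 : 0 < t by rewrite lt_min ltr01 divr_gt0.
have t1 : t <= 1 by rewrite ge_min lexx.
have te : t * 4 <= e by rewrite -ler_pdivlMr // ge_min lexx orbT.
have qa : q a = (fine (q a))%:E by rewrite fineK // ge0_fin_numE // q_fin.
have [x Kx xbig] := unbounded ((s + fine (q a)) / t).
exists ((1 - t) *: a + t *: x); first by apply: Kconvex; rewrite ?(ltW t0).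
split.
  rewrite scalerBl scale1r addrAC [a - _]addrC addrK addrC -scalerBr normrZ gtr0_norm //.
  have := ler_normB x a; have := Kbounded Ka; have := Kbounded Kx; nra.
rewrite ltNge; apply/negP => small; move: xbig; apply/negP; rewrite -leNgt.
have : (q (t *: x) <= (s + fine (q a))%:E)%E.
  rewrite -[t *: x](addKr ((1 - t) *: a)) addrC -scaleNr.
  apply: le_trans (qD _ _) _; rewrite EFinD leeD // qZ normrN -qa.
  rewrite -[leRHS]mul1e lee_wpmul2r // lee_fin ger0_norm ?subr_ge0 //.
  by rewrite gerBl ltW.
rewrite qZ gtr0_norm // => le.
by rewrite EFinM lee_pdivlMr // muleC.
Qed.

(** A pair is the centre and radius of a closed ball. Lower semicontinuity makes [q > n + 1] an open
    condition, so it holds on a whole ball around a point supplied by [large_near]. *)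
Let shrinking_step (unbounded : forall C : R, exists2 x, K x & (C%:E < q x)%E)
    (n : nat) (p : V * R) : K p.1 /\ 0 < p.2 ->
  exists p' : V * R, [/\ K p'.1 /\ 0 < p'.2, `|p'.1 - p.1| + p'.2 <= p.2,
    p'.2 <= n.+1%:R^-1 & forall y, `|y - p'.1| <= p'.2 -> (n.+1%:R%:E < q y)%E].
Proof.
case: p => a d /= [Ka d0].
have d20 : 0 < d / 2 by rewrite divr_gt0.
have [b Kb [ba qb]] := large_near unbounded Ka d20 (ltr0Sn R n).
have : open (~` [set x | (q x <= n.+1%:R%:E)%E]) by apply: closed_openC; exact: q_lsc.
rewrite openE => /(_ b) /=.
have nqb : ~ (q b <= n.+1%:R%:E)%E by apply/negP; rewrite -ltNge.
move=> /(_ nqb)/nbhs_ballP[e /= e0 be].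
(* The three terms keep the closed ball inside the open set, keep it inside the previous ball, and
   make the radii tend to 0. *)
exists (b, Num.min (e / 2) (Num.min (d / 2) n.+1%:R^-1)); split => /=.
- by split => //; rewrite !lt_min !divr_gt0 // invr_gt0 ltr0n.
- have : Num.min (e / 2) (Num.min (d / 2) n.+1%:R^-1) <= d / 2.
    by rewrite !ge_min lexx orbT.
  lra.
- by rewrite !ge_min lexx !orbT.
- move=> y yb; rewrite ltNge; apply/negP; apply: be.
  rewrite -ball_normE /= distrC (le_lt_trans yb) // !gt_min.
  by rewrite ltr_pdivrMr // ltr_pMr // ltr1n.
Qed.

(* Baire's argument with balls relative to [K]: if [q] were unbounded on [K],
   some point of [K] would lie in no sublevel set of [q]. *)
Lemma lsc_seminorm_bounded a0 : K a0 -> exists C : R, forall x, K x -> (q x <= C%:E)%E.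
Proof.
move=> Ka0; apply: contrapT => nobound.
have unbounded (C : R) : exists2 x, K x & (C%:E < q x)%E.
  apply: contrapT => none; apply: nobound; exists C => x Kx.
  by rewrite leNgt; apply/negP => Cx; apply: none; exists x.
pose S := {p : V * R | K p.1 /\ 0 < p.2}.
have /choice[f fP] (np : nat * S) : exists p' : S,
   [/\ `|(sval p').1 - (sval np.2).1| + (sval p').2 <= (sval np.2).2,
      (sval p').2 <= np.1.+1%:R^-1
    & forall y, `|y - (sval p').1| <= (sval p').2 -> (np.1.+1%:R%:E < q y)%E].
  by have [p' [p'P ? ? ?]] := shrinking_step unbounded np.1 (svalP np.2); exists (exist _ p' p'P).
pose s0 : S := exist _ (a0, 1) (conj Ka0 ltr01).
pose s := fix s n := if n is m.+1 then f (m, s m) else s0.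
pose a n := (sval (s n)).1; pose d n := (sval (s n)).2.
have Ka n : K (a n) := (svalP (s n)).1.
have d0 n : 0 < d n := (svalP (s n)).2.
have nest n m : `|a (n + m)%N - a n| + d (n + m)%N <= d n.
  elim: m => [|m IH]; first by rewrite addn0 subrr normr0 add0r.
  rewrite addnS; have [+ _ _] := fP ((n + m)%N, s (n + m)%N).
  rewrite -[f _]/(s (n + m).+1) /= -/(a _) -/(a _) -/(d _) -/(d _).
  have := ler_distD (a (n + m)%N) (a (n + m).+1) (a n); lra.
have dsmall e : 0 < e -> exists n, d n.+1 < e.
  move=> e0; exists (Num.bound e^-1); have [_ + _] := fP (Num.bound e^-1, s (Num.bound e^-1)).
  move=> /= /le_lt_trans; apply.
  rewrite invf_plt ?posrE // (lt_trans (archi_boundP _)) ?ltr_nat //.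
  by rewrite invr_ge0 ltW.
have close n m : (n <= m)%N -> `|a m - a n| <= d n.
  by move=> /subnKC <-; have := nest n (m - n)%N; have := d0 (n + (m - n))%N; lra.
have : cvg (a @ \oo).
  apply: cauchy_cvg; apply: cauchy_exP => e /dsmall[n dn].
  exists (a n.+1); exists n.+1 => // m /= nm.
  by rewrite -ball_normE /= distrC (le_lt_trans (close _ _ nm)).
move=> /cvg_ex[l al].
have Kl : K l by apply: closed_cvg al => //; apply: nearW.
have lclose n : `|l - a n| <= d n.
  apply/ler_addgt0Pr => e e0.
  have /cvgrPdist_lt/(_ e e0)[N _ aN] := al.
  have := aN (maxn N n) (leq_maxl _ _); have := close _ _ (leq_maxr N n).
  have := ler_distD (a (maxn N n)) l (a n); rewrite /=; lra.
have ql := q_fin Kl.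
(* The limit lies in every ball, in particular in one where [q] exceeds an integer above the finite
   value [q l]. *)
have [_ _ /(_ l)] := fP (Num.bound (fine (q l)), s (Num.bound (fine (q l)))).
move=> /(_ (lclose (Num.bound (fine (q l))).+1)) /=.
rewrite -[q l]fineK; last by rewrite ge0_fin_numE.
rewrite lte_fin ltNge => /negP; apply.
apply: le_trans (ltW (archi_boundP _)) _; first by rewrite fine_ge0.
by rewrite ler_nat.
Qed.

End BoundedOnConvex.

(** * The Lip-norm estimate *)

Section LipNorms.
Variables (R : realType) (A : cstarAlgType R) (L : A -> \bar R).
Hypothesis Lsemi : is_seminorm L.
Implicit Types (a b : A) (s t : R).

Lemma seminorm_ge0 a : (0 <= L a)%E.
Proof. by case: Lsemi. Qed.

Lemma seminormD a b : (L (a + b)%R <= L a + L b)%E.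
Proof. by case: Lsemi. Qed.

Lemma seminormZ (k : R[i]) a : L (k *: a) = ((Normc.normc k)%:E * L a)%E.
Proof. by case: Lsemi. Qed.

Lemma seminorm_scalM t a : L (scal A t * a) = (`|t|%:E * L a)%E.
Proof. by rewrite -scalZ seminormZ normc_real. Qed.

Lemma seminormN a : L (- a) = L a.
Proof. by rewrite -[- a]mulN1r -(scal1 A) -scalN seminorm_scalM normrN normr1 mul1e. Qed.

Lemma seminorm_imag a : L (Complex 0 1 *: a) = L a.
Proof.
by rewrite seminormZ /Normc.normc /= expr0n expr1n add0r sqrtr1 mul1e.
Qed.

(** Dilation by [r / t] carries the level [t] to the one level [r] given by the definition. *)
Lemma lsc_seminorm_closed t : lsc_seminorm L -> 0 < t ->
  closed [set a : normed_copy A | (L a <= t%:E)%E].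
Proof.
move=> [r r0 /cnorm_closedP clr] t0; apply/cnorm_closedP => x approx /=.
have rt0 : 0 < r / t by rewrite divr_gt0.
suff : (L (scal A (r / t) * x)%R <= r%:E)%E.
  rewrite seminorm_scalM gtr0_norm // -lee_pdivlMl // -EFinM invf_div.
  by rewrite divfK // gt_eqF.
apply: clr => e e0; have [y /= Ly xy] := approx (e / (r / t)) (divr_gt0 e0 rt0).
exists (scal A (r / t) * y) => /=.
  rewrite seminorm_scalM gtr0_norm // -lee_pdivlMl // -EFinM invf_div.
  by rewrite divfK // gt_eqF.
by rewrite -mulrBr cnorm_scalM gtr0_norm // mulrC -ltr_pdivlMr.
Qed.

Hypothesis L1 : L 1 = 0%E.

Lemma seminorm_scal t : L (scal A t) = 0%E.
Proof. by rewrite -[scal A t]mulr1 seminorm_scalM L1 mule0. Qed.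

Hypothesis Lstar : forall a, L (star a) = L a.

Lemma seminorm_repart a : (L (repart a) <= L a)%E.
Proof.
rewrite seminorm_scalM gtr0_norm ?invr_gt0 //.
rewrite muleC lee_pdivrMr // muleC.
apply: le_trans (seminormD _ _) _; rewrite Lstar.
by rewrite (_ : 2 = 1 + 1 :> R) // EFinD ge0_muleDl ?lee_fin // mul1e.
Qed.

Lemma seminorm_impart a : (L (impart a) <= L a)%E.
Proof. by rewrite (le_trans (seminorm_repart _)) // seminormN seminorm_imag. Qed.

(** Take [r = phi a] for a fixed state [phi]. A state [psi] norming [a - r] gives
    [|a - r| = |psi a - phi a|], which the diameter estimate bounds. *)
Lemma lip_norm_radius : induces_weak_star (lip_dist L) ->
  exists2 D : R, 0 < D & forall a, selfadj a -> (L a <= 1)%E ->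
    exists r : R, cnorm (a - scal A r) <= D.
Proof.
(* Norming the element 0 merely provides some state. *)
move=> weak; have [phi st _] := norming_state (selfadj_scal A 0).
pose phi0 : states A := exist _ (phi : {ptws A -> R[i]^o}) (mem_set st).
have [D D0 Dle] := lip_dist_bounded phi0 L1 weak.
exists D => // a saa La.
have [r phia _] := state_selfadj (state_funP phi0) saa.
exists r.
have [|psi stp <-] := norming_state (_ : selfadj (a - scal A r)).
  by apply: selfadjB => //; exact: selfadj_scal.
pose psi0 : states A := exist _ (psi : {ptws A -> R[i]^o}) (mem_set stp).
have := Dle psi0 a La; rewrite phia.
rewrite /state_fun set_valE /= => le.
by rewrite stateD // stateN // state_scal // -normc_opp opprB.
Qed.

End LipNorms.

(** * Contractivity of unital star-homomorphisms *)

Section StarMorphism.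
Variables (R : realType) (A1 A2 : cstarAlgType R) (T : {lrmorphism A1 -> A2}).
Hypothesis T_star : forall a : A1, T (star a) = star (T a).

Lemma morph_scal t : T (scal A1 t) = scal A2 t.
Proof. by rewrite linearZ rmorph1. Qed.

Lemma morph_scalM t a : T (scal A1 t * a) = scal A2 t * T a.
Proof. by rewrite -morph_scal -rmorphM. Qed.

(** For self-adjoint [b] and [t > |b|], the element [t - b] is a square, hence so is its image
    [t - T b]. Applied to [star a * a] and its opposite, this bounds [|T a| ^+ 2]. *)
Lemma star_morph_contractive a : cnorm (T a) <= cnorm a.
Proof.
have contr b t : selfadj b -> cnorm b < t -> pos (scal A2 t - T b).
  move=> sab bt; have [||u [sau uE _]] := @sqrt_exists _ _ (scal A1 t - b) t.
  - by apply: selfadjB => //; exact: selfadj_scal.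
  - by rewrite opprB addrCA subrr addr0.
  rewrite -morph_scal -rmorphB uE rmorphXn; apply: pos_sqr.
  by rewrite /selfadj -T_star sau.
rewrite -ler_sqr ?nnegrE ?cnorm_ge0 // -!cnorm_starM -T_star -rmorphM.
have sah := selfadj_starM a; apply/ler_addgt0Pr => e e0.
have he : cnorm (star a * a) < cnorm (star a * a) + e by rewrite ltrDl.
apply: cnorm_le_abs; first by rewrite addr_ge0 ?cnorm_ge0 // ltW.
  exact: contr.
rewrite -[X in pos (_ + X)]opprK -rmorphN; apply: contr; first exact: selfadjN.
by rewrite cnormN.
Qed.

End StarMorphism.

Theorem theorem1p1 (R : realType) (A1 A2 : cstarAlgType R)
    (L1 : A1 -> \bar R) (L2 : A2 -> \bar R)
    (hL1 : cstar_metric L1) (hL2 : cstar_metric L2)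
    (lscL1 : lsc_seminorm L1) (lscL2 : lsc_seminorm L2)
    (T : {lrmorphism A1 -> A2})
    (T_star : forall a : A1, T (star a) = star (T a))
    (T_dom : T @` lip_dom L1 `<=` lip_dom L2) :
  exists2 mu : R, 0 <= mu &
    forall a : A1, lip_dom L1 a -> (L2 (T a) <= mu%:E * L1 a)%E.
Proof.
case: hL1 => -[semi1 one1 star1 weak1] _; case: hL2 => -[semi2 one2 star2 _] _.
pose K : set (normed_copy A1) := [set a : A1 | (L1 a <= 1%:E)%E /\ cnorm a <= 1].
have K0 : K (0 : A1).
  by split; rewrite ?cnorm0 // -(scal0 A1) seminorm_scal // lee_fin ler01.
have [C qC] : exists C : R, forall a : A1, K a -> (L2 (T a) <= C%:E)%E.
  apply: (@lsc_seminorm_bounded R (normed_copy A1) K (fun a => L2 (T (a : A1)))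
    _ _ _ _ _ _ _ _ _ K0).
  - apply/cnorm_closedP => x approx; split.
      have /cnorm_closedP cl1 := lsc_seminorm_closed semi1 lscL1 (@ltr01 R).
      by apply: cl1 => e /approx[y [Ly _] xy]; exists y.
    apply/ler_addgt0Pr => e /approx[y [_ y1] xy].
    rewrite -[x](subrK y) addrC.
    by rewrite (le_trans (cnormD _ _)) // lerD // ltW.
  - move=> x y t [Lx x1] [Ly y1] /andP[t0 t1].
    have -> : (1 - t) *: x + t *: y = scal A1 (1 - t) * x + scal A1 t * y :> A1.
      by rewrite -!scalZ.
    have u0 : 0 <= 1 - t by rewrite subr_ge0.
    split.
      apply: le_trans (seminormD semi1 _ _) _.
      rewrite !seminorm_scalM // !ger0_norm //.
      have -> : 1%:E = ((1 - t)%:E + t%:E)%E :> \bar R by rewrite -EFinD subrK.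
      by apply: leeD; rewrite -[leRHS]mule1 lee_wpmul2l // lee_fin.
    rewrite (le_trans (cnormD _ _)) // !cnorm_scalM !ger0_norm //; nra.
  - by move=> x [].
  - by move=> x; exact: seminorm_ge0.
  - move=> x y /=; have -> : T (x + y) = T x + T y by exact: (rmorphD T).
    exact: seminormD.
  - move=> t x /=; have -> : T (t *: x) = scal A2 t * T (x : A1).
      by rewrite -morph_scalM; congr (T _); exact: scalZ.
    exact: seminorm_scalM.
  (* Contractivity of [T] pulls the closed sublevel sets of [L2] back to closed sets. *)
  - move=> s s0; apply/cnorm_closedP => x approx /=.
    have /cnorm_closedP cl2 := lsc_seminorm_closed semi2 lscL2 s0.
    apply: cl2 => e /approx[y Ly xy]; exists (T y) => //.
    rewrite -rmorphB (le_lt_trans _ xy) //; exact: star_morph_contractive.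
  - move=> x [Lx _]; apply: T_dom; exists x => //.
    by rewrite /lip_dom /= (le_lt_trans Lx) // ltry.
have C0 : 0 <= C by rewrite -lee_fin; apply: le_trans (qC _ K0); exact: seminorm_ge0.
have [D D0 rad] := lip_norm_radius one1 weak1.
(* With [M >= D] and [M >= 1], division by [M] brings the norm below 1 and keeps [L1] at most 1. *)
pose M := D + 1; have M0 : 0 < M by rewrite addr_gt0.
have M1 : 1 <= M by rewrite lerDr ltW.
have boundsa a : selfadj a -> (L1 a <= 1)%E -> (L2 (T a) <= (M * C)%:E)%E.
  move=> saa La; have [r ar] := rad a saa La.
  have Kb : K (scal A1 M^-1 * (a - scal A1 r)).
    split.
      rewrite seminorm_scalM // gtr0_norm ?invr_gt0 // muleC lee_pdivrMr //.
      apply: le_trans (seminormD semi1 _ _) _.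
      rewrite seminormN // seminorm_scal // adde0 mul1e.
      by rewrite (le_trans La) // lee_fin.
    rewrite cnorm_scalM gtr0_norm ?invr_gt0 // mulrC ler_pdivrMr // mul1r.
    by rewrite (le_trans ar) // lerDl.
  have -> : T a = scal A2 M * T (scal A1 M^-1 * (a - scal A1 r)) + scal A2 r.
    rewrite -morph_scalM -(morph_scal T) -rmorphD mulrA -scalM mulfV ?gt_eqF //.
    by rewrite scal1 mul1r subrK.
  apply: le_trans (seminormD semi2 _ _) _.
  rewrite seminorm_scal // adde0 seminorm_scalM // gtr0_norm // EFinM.
  by rewrite lee_wpmul2l ?lee_fin ?(ltW M0) //; exact: qC.
(* One summand for the real part of [a] and one for the imaginary part. *)
pose mu := M * C + M * C.
have mu0 : 0 <= mu by rewrite addr_ge0 // mulr_ge0 // ltW.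
have bound a : (L1 a <= 1)%E -> (L2 (T a) <= mu%:E)%E.
  move=> La; rewrite -[a]repartK linearD linearZ.
  apply: le_trans (seminormD semi2 _ _) _; rewrite seminorm_imag // EFinD.
  apply: leeD; apply: boundsa.
  - exact: selfadj_repart.
  - by rewrite (le_trans (seminorm_repart _ _ _)).
  - exact: selfadj_repart.
  - by rewrite (le_trans (seminorm_impart _ _ _)).
exists mu => // a La.
have L1fin : L1 a \is a fin_num by rewrite ge0_fin_numE // seminorm_ge0.
have L2fin : L2 (T a) \is a fin_num.
  by rewrite ge0_fin_numE ?seminorm_ge0 //; apply: T_dom; exists a.
rewrite -(fineK L1fin) -(fineK L2fin) -EFinM lee_fin.
(* Normalising by [L1 a + e] instead of [L1 a] also covers [L1 a = 0]. *)
apply: (@ler_scaled_eps _ mu) => e e0.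
have s0 : 0 <= fine (L1 a) by rewrite fine_ge0 // seminorm_ge0.
have se : 0 < fine (L1 a) + e by rewrite ltr_wpDl.
have L1le : (L1 (scal A1 (fine (L1 a) + e)^-1 * a)%R <= 1)%E.
  rewrite seminorm_scalM // gtr0_norm ?invr_gt0 // -(fineK L1fin) -EFinM lee_fin.
  by rewrite ler_pdivrMl // mulr1 lerDl ltW.
have := bound _ L1le.
rewrite morph_scalM seminorm_scalM // gtr0_norm ?invr_gt0 // -(fineK L2fin) -EFinM.
by rewrite lee_fin ler_pdivrMl // mulrC mulrDr.
Qed.
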